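(* Let $n\ge1$ and let $\mathcal{G}$ be an abelian subgroup of $GA(n,\mathbb{C})$ generated by $p$ elements. Let $r$ be the number of blocks associated to $\mathcal{G}$ as in the context. If $p\le 2n-r+1$, then $\mathcal{G}$ has no dense orbit in $\mathbb{C}^n$.
   Context: $GA(n,\mathbb{C})$ is the group (under composition) of invertible affine maps $f=(A,a):x\mapsto Ax+a$ of $\mathbb{C}^n$, with $A\in GL(n,\mathbb{C})$, $a\in\mathbb{C}^n$. The orbit of $v\in\mathbb{C}^n$ is $\mathcal{G}(v)=\{f(v):f\in\mathcal{G}\}$. Define the group homomorphism $\Phi:GA(n,\mathbb{C})\to GL(n+1,\mathbb{C})$, $\Phi(A,a)=\begin{bmatrix}1&0\\ a&A\end{bmatrix}$, and put $G=\Phi(\mathcal{G})$. For $m\ge1$, $\mathbb{T}_m(\mathbb{C})$ is the set of lower triangular $m\times m$ complex matrices all of whose diagonal entries are equal. For $\eta=(n_1,\dots,n_r)$ a sequence of positive integers with $n_1+\dots+n_r=n+1$, $\mathcal{K}_{\eta,r}(\mathbb{C})=\mathbb{T}_{n_1}(\mathbb{C})\oplus\dots\oplus\mathbb{T}_{n_r}(\mathbb{C})$ (block diagonal matrices) and $\mathcal{K}^*_{\eta,r}(\mathbb{C})=\mathcal{K}_{\eta,r}(\mathbb{C})\cap GL(n+1,\mathbb{C})$. There always exist $P\in\Phi(GA(n,\mathbb{C}))$ and such an $\eta$ with $P^{-1}GP\subset\mathcal{K}^*_{\eta,r}(\mathbb{C})\cap\Phi(GA(n,\mathbb{C}))$;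 fix such a choice. The integer $r$ is the length of $\eta$. *)

(* Defs.v *)
From HB Require Import structures.
From mathcomp Require Import all_boot all_order all_algebra.
From mathcomp Require Import complex.
From mathcomp Require Import all_classical all_reals all_analysis.

Set Implicit Arguments.
Unset Strict Implicit.
Unset Printing Implicit Defensive.

Import GRing.Theory Num.Theory.
Import numFieldNormedType.Exports.

Local Open Scope classical_set_scope.
Local Open Scope ring_scope.

(* Typing the complex numbers as a [numFieldType] equips ['cV[Cplx R]_n] with
   the product topology of the topology of the modulus. *)
Definition Cplx (R : realType) : numFieldType := R[i].

Section Affine.
Variables (F : fieldType) (n : nat).

Record GA := MkGA {
  aff_pair : 'M[F]_n * 'cV[F]_n;
  aff_pairP : aff_pair.1 \in unitmx }.

HB.instance Definition _ := [isSub for aff_pair].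
HB.instance Definition _ := [Choice of GA by <:].

Definition lin_part (f : GA) : 'M[F]_n := (aff_pair f).1.
Definition trans_part (f : GA) : 'cV[F]_n := (aff_pair f).2.

Definition aff_app (f : GA) (x : 'cV[F]_n) : 'cV[F]_n :=
  lin_part f *m x + trans_part f.

Lemma lin_part_unit f : lin_part f \in unitmx.
Proof. exact: aff_pairP. Qed.

Fact aff_one_subproof : ((1%:M : 'M[F]_n), (0 : 'cV[F]_n)).1 \in unitmx.
Proof. exact: unitmx1. Qed.
Definition aff_one : GA := MkGA aff_one_subproof.

Fact aff_mul_subproof (f g : GA) :
  (lin_part f *m lin_part g, aff_app f (trans_part g)).1 \in unitmx.
Proof. by rewrite /= unitmx_mul !lin_part_unit. Qed.
Definition aff_mul (f g : GA) : GA := MkGA (aff_mul_subproof f g).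

Fact aff_inv_subproof (f : GA) :
  (invmx (lin_part f), - (invmx (lin_part f) *m trans_part f)).1 \in unitmx.
Proof. by rewrite /= unitmx_inv lin_part_unit. Qed.
Definition aff_inv (f : GA) : GA := MkGA (aff_inv_subproof f).

Lemma aff_mulA : associative aff_mul.
Proof.
move=> f g h; apply: val_inj => /=.
by congr pair; rewrite /aff_app /lin_part /trans_part /= ?mulmxDr !mulmxA ?addrA.
Qed.

Lemma aff_mul1 : left_id aff_one aff_mul.
Proof.
move=> f; apply: val_inj; rewrite /= /aff_app /lin_part /trans_part /= !mul1mx.
by rewrite addr0; case: (aff_pair f).
Qed.

Lemma aff_mulr1 : right_id aff_one aff_mul.
Proof.
move=> f; apply: val_inj; rewrite /= /aff_app /lin_part /trans_part /= mulmx1.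
by rewrite mulmx0 add0r; case: (aff_pair f).
Qed.

Lemma aff_mulV : left_inverse aff_one aff_inv aff_mul.
Proof.
move=> f; apply: val_inj; rewrite /= /aff_app /lin_part /trans_part /=.
by rewrite mulVmx ?subrr //; exact: lin_part_unit.
Qed.

Lemma aff_mulrV : right_inverse aff_one aff_inv aff_mul.
Proof.
move=> f; apply: val_inj; rewrite /= /aff_app /lin_part /trans_part /=.
rewrite mulmxV; last exact: lin_part_unit.
by rewrite mulmxN mulmxA mulmxV ?mul1mx ?addNr //; exact: lin_part_unit.
Qed.

HB.instance Definition _ :=
  isGroup.Build GA aff_mulA aff_mul1 aff_mulr1 aff_mulV aff_mulrV.

Lemma aff_app_mul (f g : GA) x : aff_app (f * g)%g x = aff_app f (aff_app g x).
Proof. by rewrite /aff_app /= mulmxDr !mulmxA addrA. Qed.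

Definition orbit_of (G : set GA) (v : 'cV[F]_n) : set 'cV[F]_n :=
  [set aff_app f v | f in G].

Definition Phi (f : GA) : 'M[F]_(1 + n) :=
  block_mx 1%:M 0 (trans_part f) (lin_part f).

Lemma Phi_mul (f g : GA) : Phi (f * g)%g = Phi f *m Phi g.
Proof.
rewrite /Phi mulmx_block !mul1mx !mul0mx !mulmx0 !mulmx1 !addr0 add0r.
by rewrite [trans_part f + _]addrC.
Qed.

Lemma Phi_unit (f : GA) : Phi f \in unitmx.
Proof. by rewrite unitmxE det_lblock det1 mul1r -unitmxE lin_part_unit. Qed.

End Affine.

Section Generated.
Variable gT : groupType.

Definition is_subgroup (H : set gT) : Prop := group_closed [in H].

Definition generated_by (X : set gT) : set gT := smallest is_subgroup X.

(* The [p] generators need not be pairwise distinct. *)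
Definition generated_by_elements (p : nat) (H : set gT) : Prop :=
  exists g : 'I_p -> gT, H = generated_by (range g).

Definition is_abelian (H : set gT) : Prop :=
  forall f g, H f -> H g -> commute f g.

End Generated.

Section Blocks.
Variable F : fieldType.

(* [is_trig_mx] means lower triangular. *)
Definition TT (m : nat) : set 'M[F]_m :=
  [set M | is_trig_mx M /\ forall i j, M i i = M j j].

Definition KK (N r : nat) (eta : 'I_r -> nat)
    (eta_sum : (\sum_(i < r) eta i)%N = N) : set 'M[F]_N :=
  [set castmx (eta_sum, eta_sum) (\mxdiag_(i < r) B i)
     | B in [set B : forall i, 'M[F]_(eta i) | forall i, TT (B i)]].

Definition KKstar (N r : nat) (eta : 'I_r -> nat)
    (eta_sum : (\sum_(i < r) eta i)%N = N) : set 'M[F]_N :=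
  KK eta_sum `&` [set M | M \in unitmx].

End Blocks.

(* Main.v *)
Require Import Defs.
From HB Require Import structures.
From mathcomp Require Import all_boot all_order all_algebra.
From mathcomp Require Import complex.
From mathcomp Require Import all_classical all_reals all_analysis.
From mathcomp Require Import zify lra.

(* Put [N = 1 + n]. Lifting [v] to [(1, v)] and conjugating by [P], a dense
   orbit gives a set [S] of commuting block triangular matrices and a vector [u]
   such that [S u] is dense in the hyperplane [w_0 = 1]. Hence [u] is cyclic, and
   evaluation at [u] identifies the span of [S] with the whole space.
   Invertible block triangular matrices have additive real coordinates:
   [ln |x_ii|] for each block, and the real and imaginary parts of the entries of
   [log (unipotent part of x) u], which vanish at the first index of each block.
   As the entry [x_00] is 1, this leaves [(r - 1) + 2 (N - r) = 2n - r + 1]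
   coordinates, independent on the span of [S]. Since [p] is at most that number,
   some nonzero real combination of them is an integer at each of the [p]
   generators, hence on all of [S]. But it takes the value 1/2 at a point of the
   hyperplane, so by density and continuity it comes close to 1/2 on [S]. *)

Set Implicit Arguments.
Unset Strict Implicit.
Unset Printing Implicit Defensive.
Import Order.TTheory GRing.Theory Num.Theory.
Import numFieldNormedType.Exports.
Local Open Scope classical_set_scope.
Local Open Scope ring_scope.

(** * Exponential and logarithm of triangular matrices *)

Section TriangularExp.
Variables (F : numFieldType) (N : nat).
Implicit Types (x y z : 'M[F]_N) (k l : nat).

Let scale_mull a x y : (a *: x) * y = a *: (x * y).
Proof. by symmetry; apply: scalemxAl. Qed.

Let scale_mulr a x y : x * (a *: y) = a *: (x * y).
Proof. by symmetry; apply: scalemxAr. Qed.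

(** [band 0] is lower triangular and [band 1] strictly lower triangular. The index adds under
    products, so [band 1] matrices are nilpotent. *)
Definition band k x := forall i j : 'I_N, (i < j + k)%N -> x i j = 0.

Lemma band0 k : band k 0.
Proof. by move=> i j _; rewrite mxE. Qed.

Lemma band1 : band 0 1.
Proof.
by move=> i j; rewrite addn0 !mxE => /ltn_eqF; rewrite -val_eqE => ->.
Qed.

Lemma bandD k x y : band k x -> band k y -> band k (x + y).
Proof. by move=> bx b_y i j ij; rewrite mxE bx ?b_y ?addr0. Qed.

Lemma bandZ k a x : band k x -> band k (a *: x).
Proof. by move=> bx i j ij; rewrite mxE bx ?mulr0. Qed.

Lemma bandN k x : band k x -> band k (- x).
Proof. by rewrite -scaleN1r; apply: bandZ. Qed.

Lemma band_sum (I : finType) k (f : I -> 'M[F]_N) :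
  (forall i, band k (f i)) -> band k (\sum_i f i).
Proof.
by move=> bf; elim/big_rec: _ => [|i x _ bx]; [exact: band0 | exact: bandD].
Qed.

Lemma bandM k l x y : band k x -> band l y -> band (k + l) (x * y).
Proof.
move=> bx b_y i j ij; rewrite mxE big1 // => m _.
have [im|mi] := ltnP i (m + k); first by rewrite bx ?mul0r.
rewrite [y m j]b_y ?mulr0 // -(ltn_add2r k); apply: leq_ltn_trans mi _.
by rewrite -addnA [(l + k)%N]addnC.
Qed.

Lemma band_le k l x : band l x -> (k <= l)%N -> band k x.
Proof. by move=> bx kl i j ij; rewrite bx // (leq_trans ij) ?leq_add2l. Qed.

Lemma band_eq0 k x : (N <= k)%N -> band k x -> x = 0.
Proof.
move=> Nk bx; apply/matrixP => i j; rewrite mxE bx //.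
by rewrite (leq_trans (ltn_ord i)) // (leq_trans Nk) ?leq_addl.
Qed.

Lemma bandX k x : band 1 x -> band k (x ^+ k).
Proof.
move=> bx; elim: k => [|k IHk]; first by rewrite expr0; apply: band1.
by rewrite exprS -add1n; apply: bandM.
Qed.

(** The exponential series cut at degree [N + 1], exact on [band 1], where [x ^+ N = 0]. The bound
    [N.+2] leaves room to split off [1 + x] even for [N = 0]. *)
Definition mexp x := \sum_(i < N.+2) i`!%:R^-1 *: x ^+ i.

Definition mexp_tail x := \sum_(i < N) (i.+2)`!%:R^-1 *: x ^+ i.

Lemma mexpE x : mexp x = 1 + x + x * x * mexp_tail x.
Proof.
rewrite /mexp !big_ord_recl /= !expr0 expr1 invr1 !scale1r addrA; congr (_ + _).
rewrite /mexp_tail mulr_sumr; apply: eq_bigr => i _.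
by rewrite /bump /= !add1n !exprS mulrA scale_mulr.
Qed.

Lemma band_mexp_tail x : band 1 x -> band 0 (mexp_tail x).
Proof.
move=> bx; apply: band_sum => i; apply: bandZ.
exact: (band_le (@bandX i _ bx)).
Qed.

Lemma mexp0 : mexp 0 = 1.
Proof. by rewrite mexpE !mul0r !addr0. Qed.

Lemma comm_mexp x y : GRing.comm y x -> GRing.comm y (mexp x).
Proof.
move=> cyx; apply: commr_sum => i _.
by rewrite /GRing.comm scale_mull scale_mulr (commrX i cyx).
Qed.

(** The binomial theorem turns the left side into a sum over a triangle of pairs of exponents, while
    the right side runs over a square. The pairs outside the triangle give products of more than [N]
    strictly triangular factors, hence zero. *)
Lemma mexpD x y : band 1 x -> band 1 y -> GRing.comm x y ->
  mexp (x + y) = mexp x * mexp y.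
Proof.
move=> bx b_y cxy; set K := N.+2.
pose t i j : 'M[F]_N := (j`!%:R^-1 * i`!%:R^-1) *: (x ^+ j * y ^+ i).
have tE (k i : nat) : (i <= k)%N ->
    k`!%:R^-1 *: ((x ^+ (k - i) * y ^+ i) *+ 'C(k, i)) = t i (k - i)%N.
  move=> ik; rewrite -[_ *+ 'C(k, i)]scaler_nat scalerA /t; congr (_ *: _).
  have fact_neq0 j : j`!%:R != 0 :> F by rewrite pnatr_eq0 -lt0n fact_gt0.
  rewrite -(bin_fact ik) !natrM !invfM.
  have C_neq0 : 'C(k, i)%:R != 0 :> F by rewrite pnatr_eq0 -lt0n bin_gt0.
  by rewrite [LHS]mulrC mulVKf // mulrC.
have -> : mexp x * mexp y = \sum_(0 <= i < K) \sum_(0 <= j < K) t i j.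
  rewrite /mexp mulr_sumr big_mkord; apply: eq_bigr => i _.
  rewrite mulr_suml big_mkord; apply: eq_bigr => j _.
  by rewrite scale_mull scale_mulr scalerA.
have -> : mexp (x + y) =
    \sum_(0 <= k < K) \sum_(0 <= i < K | (i <= k)%N) t i (k - i)%N.
  rewrite /mexp big_mkord; apply: eq_bigr => k _.
  rewrite (exprDn_comm k cxy) scaler_sumr -(big_mkord xpredT
    (fun i => k`!%:R^-1 *: ((x ^+ (k - i) * y ^+ i) *+ 'C(k, i)))).
  rewrite (big_nat_widen _ _ K) ?ltn_ord //.
  by apply: eq_big => // i; rewrite /= ltnS => ik; rewrite tE.
rewrite (exchange_big_dep_nat xpredT) //=.
rewrite big_nat_cond [RHS]big_nat_cond; apply: eq_bigr => i.
rewrite andbT => /andP[_ iK].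
rewrite [RHS](big_cat_nat (n := (K - i)%N) (m := 0%N) (p := K)) ?leq_subr //=.
rewrite [X in _ = _ + X]big_nat_cond [X in _ = _ + X]big1 ?addr0; last first.
  move=> j /andP[/andP[Kij _] _]; rewrite /t.
  suff -> : x ^+ j * y ^+ i = 0 by rewrite scaler0.
  apply: (@band_eq0 (j + i)); last by apply: bandM; apply: bandX.
  rewrite leq_subLR in Kij.
  by rewrite addnC (leq_trans _ Kij) // /K; apply/leqW/leqW.
rewrite -(big_nat_widenl i 0 K xpredT) //.
by rewrite -{1}(add0n i) big_addn; apply: eq_bigr => j _; rewrite addnK.
Qed.

Lemma mexpN x : band 1 x -> mexp x * mexp (- x) = 1.
Proof.
move=> bx; rewrite -mexpD ?subrr ?mexp0 //; first exact: bandN.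
exact/commrN.
Qed.

(** With [z = x - y], the equation [mexp z = 1] makes [z] a multiple of [z * z], so each use of it
    moves [z] one band further down, until [z] vanishes. *)
Lemma mexp_inj x y : band 1 x -> band 1 y -> GRing.comm x y ->
  mexp x = mexp y -> x = y.
Proof.
move=> bx b_y cxy exy; apply/eqP; rewrite -subr_eq0; apply/eqP.
set z := x - y.
have bz : band 1 z by apply: bandD => //; apply: bandN.
have ez : mexp z = 1.
  by rewrite mexpD ?exy ?mexpN //; [exact: bandN | exact: commrN].
have zE : z = - (z * z * mexp_tail z).
  move: ez; rewrite mexpE -addrA -[RHS]addr0 => /addrI.
  by move/eqP; rewrite addr_eq0 => /eqP.
suff bkz k : band k.+1 z by apply: band_eq0 (bkz N).
elim: k => // k IHk; rewrite zE; apply: bandN.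
rewrite -[k.+2]addn0 -[k.+2]addn1.
by apply: bandM; [apply: bandM | apply: band_mexp_tail].
Qed.

(* Dividing [1 + x] by [exp x] pushes [x] one band further down, so that after
   [N] steps nothing is left: the logarithm is the sum of the [x]s met. *)
Fixpoint mlog_rec k x :=
  if k is k'.+1 then x + mlog_rec k' ((1 + x) * mexp (- x) - 1) else 0.

Definition mlog u := mlog_rec N (u - 1).

(** The linear terms cancel because [(1 + x) * (1 - x) = 1 - x * x]; the remaining factor [x * x] is
    what raises the band index. *)
Lemma mlog_stepE x : (1 + x) * mexp (- x) - 1 =
  x * x * ((1 + x) * mexp_tail (- x) - 1).
Proof.
rewrite mexpE mulrNN.
have cx : GRing.comm (x * x) (1 + x).
  by apply: commrD; [exact: commr1 | rewrite /GRing.comm mulrA].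
have sq : (1 + x) * (1 - x) = 1 - x * x.
  by rewrite mulrBr mulr1 mulrDl mul1r opprD addrA addrK.
rewrite mulrDr sq (mulrA (1 + x)) -cx -(mulrA (x * x)) mulrBr mulr1.
by rewrite addrAC [1 - _]addrC addrK addrC.
Qed.

Lemma band_mlog_step k x : band 1 x -> band k x ->
  band k.+1 ((1 + x) * mexp (- x) - 1).
Proof.
move=> b1x bkx; rewrite mlog_stepE -[k.+1]addn0 -[k.+1]addn1.
apply: bandM; first exact: bandM.
apply: bandD; last by apply: bandN; exact: band1.
rewrite -[0%N]addn0; apply: bandM; last by apply/band_mexp_tail/bandN.
by apply: bandD; [exact: band1 | exact: band_le b1x _].
Qed.

Lemma comm_mlog_step x y :
  GRing.comm y x -> GRing.comm y ((1 + x) * mexp (- x) - 1).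
Proof.
move=> cyx; apply: commrB; last exact: commr1.
apply: commrM; first by apply: commrD => //; exact: commr1.
exact/comm_mexp/commrN.
Qed.

Lemma band_mlog_rec k x : band 1 x -> band 1 (mlog_rec k x).
Proof.
elim: k x => [|k IHk] x bx /=; first exact: band0.
by apply: bandD => //; apply/IHk/(band_le (band_mlog_step bx bx) _).
Qed.

Lemma comm_mlog_rec k x y : GRing.comm y x -> GRing.comm y (mlog_rec k x).
Proof.
elim: k x => [|k IHk] x cyx /=; first exact: commr0.
by apply: commrD => //; apply/IHk/comm_mlog_step.
Qed.

(** The invariant is that with [k] steps left [x] has already reached band [N - k]; at [k = 0] this
    forces [x = 0]. *)
Lemma mexp_mlog_rec k x : band 1 x -> band (N - k) x ->
  mexp (mlog_rec k x) = 1 + x.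
Proof.
elim: k x => [|k IHk] x b1x bx /=.
  by rewrite (band_eq0 _ bx) ?subn0 // mexp0 addr0.
have by1 := band_mlog_step b1x b1x; set y := _ - 1 in by1 *.
have cxy : GRing.comm x y by apply: comm_mlog_step.
rewrite mexpD //; last exact: comm_mlog_rec; last first.
- exact/band_mlog_rec/(band_le by1 _).
rewrite IHk; last first.
- by apply: (band_le (band_mlog_step b1x bx) _); rewrite subnS; case: (N - k)%N.
- exact: band_le by1 _.
rewrite addrC subrK.
have ce : GRing.comm (mexp x) (1 + x).
  apply: commrD; first exact: commr1.
  exact/commr_sym/comm_mexp.
by rewrite mulrA ce -mulrA mexpN ?mulr1.
Qed.

Lemma band_mlog u : band 1 (u - 1) -> band 1 (mlog u).
Proof. exact: band_mlog_rec. Qed.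

Lemma comm_mlog u y : GRing.comm y u -> GRing.comm y (mlog u).
Proof. by move=> cyu; apply/comm_mlog_rec/commrB => //; exact: commr1. Qed.

Lemma mlogK u : band 1 (u - 1) -> mexp (mlog u) = u.
Proof.
move=> bu; rewrite mexp_mlog_rec ?subrKC //.
by rewrite subnn; apply: band_le bu _.
Qed.

Lemma band_mexpB1 x : band 1 x -> band 1 (mexp x - 1).
Proof.
move=> bx; rewrite mexpE -(addrA 1) (addrC 1) addrK; apply: bandD => //.
apply: (@band_le _ (1 + 1 + 0)%N) => //.
by apply: bandM; [exact: bandM | exact: band_mexp_tail].
Qed.

Lemma mexpK x : band 1 x -> mlog (mexp x) = x.
Proof.
move=> bx; have be := band_mexpB1 bx.
apply: mexp_inj => //; last exact: mlogK; first exact: band_mlog.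
exact/commr_sym/comm_mlog/comm_mexp.
Qed.

Lemma band_unitriM u v : band 1 (u - 1) -> band 1 (v - 1) -> band 1 (u * v - 1).
Proof.
move=> bu bv; have -> : u * v - 1 = (u - 1) * (v - 1) + (u - 1) + (v - 1).
  by rewrite mulrBl mul1r mulrBr mulr1 addrAC subrK addrA subrK.
apply: bandD => //; apply: bandD => //.
by apply: (@band_le _ (1 + 1)%N) => //; exact: bandM.
Qed.

(** Both sides commute and exponentiate to [u * v], so [mexp_inj] applies. *)
Lemma mlogM u v : band 1 (u - 1) -> band 1 (v - 1) -> GRing.comm u v ->
  mlog (u * v) = mlog u + mlog v.
Proof.
move=> bu bv cuv; have buv := band_unitriM bu bv.
have cl y w : GRing.comm y w -> GRing.comm (mlog y) (mlog w).
  by move=> yw; apply/comm_mlog/commr_sym/comm_mlog/commr_sym.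
apply: mexp_inj; [exact: band_mlog | by apply: bandD; exact: band_mlog | | ].
  have cuvu : GRing.comm (u * v) u by rewrite /GRing.comm -mulrA -cuv.
  have cuvv : GRing.comm (u * v) v by rewrite /GRing.comm mulrA cuv.
  by apply: commrD; apply: cl.
rewrite mlogK // mexpD ?mlogK //; [exact: band_mlog.. | exact: cl].
Qed.

End TriangularExp.

(** * Block triangular matrices *)

Section BlockTriangular.
Variables (F : numFieldType) (N : nat) (T : eqType) (beta : 'I_N -> T).
Implicit Types (x y : 'M[F]_N).

(** [beta] labels each index with its block, so that the block structure of [KK] is expressed entry
    by entry, without dependently sized blocks. *)
Definition block_trig x :=
  (forall i j : 'I_N, (i < j)%N || (beta i != beta j) -> x i j = 0) /\
  (forall i j, beta i = beta j -> x i i = x j j).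

Lemma block_trig_sum (I : finType) (f : I -> 'M[F]_N) :
  (forall k, block_trig (f k)) -> block_trig (\sum_k f k).
Proof.
move=> bf; split=> i j ij; rewrite !summxE.
  by rewrite big1 // => k _; apply: (bf k).1.
by apply: eq_bigr => k _; apply: (bf k).2.
Qed.

Lemma block_trigZ a x : block_trig x -> block_trig (a *: x).
Proof.
move=> bx; split=> i j ij; rewrite !mxE; first by rewrite bx.1 ?mulr0.
by rewrite (bx.2 i j).
Qed.

Lemma block_trig_band x : block_trig x -> band 0 x.
Proof. by move=> bx i j; rewrite addn0 => ij; apply: bx.1; rewrite ij. Qed.

Lemma diag_mulmx x y i : band 0 x -> band 0 y ->
  (x *m y) i i = x i i * y i i.
Proof.
move=> bx b_y; rewrite mxE (bigD1 i) //= big1 ?addr0 // => k.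
rewrite -val_eqE /=; case: ltngtP => // ki _.
  by rewrite b_y ?mulr0 ?addn0.
by rewrite bx ?mul0r ?addn0.
Qed.

(** For an invertible block triangular [x] the diagonal is scalar on each block, and dividing it out
    leaves the unipotent Jordan factor. *)
Definition unip x := \matrix_(i, j) (x i j / x i i).

(** The terms that survive in a product entry have [k] in the block of [i], where [y k k = y i i];
    so the denominator [y i i] can be moved inside the sum. *)
Lemma unipM x y : block_trig x -> block_trig y ->
  unip (x *m y) = unip x *m unip y.
Proof.
move=> bx b_y; apply/matrixP => i j.
rewrite [LHS]mxE diag_mulmx; [|exact: block_trig_band..].
rewrite !mxE mulr_suml; apply: eq_bigr => k _; rewrite !mxE invfM.
have [ik|ik] := eqVneq (beta i) (beta k).
  by rewrite (b_y.2 i k) // mulrACA.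
by rewrite (bx.1 i k) ?ik ?orbT // !mul0r.
Qed.

Lemma band_unip x : block_trig x -> (forall i, x i i != 0) ->
  band 1 (unip x - 1).
Proof.
move=> bx x0 i j; rewrite addn1 ltnS leq_eqVlt => /orP[/eqP/val_inj->|ij].
  by rewrite !mxE eqxx divff ?subrr.
by rewrite !mxE bx.1 ?ij // mul0r -val_eqE ltn_eqF ?subrr.
Qed.

Lemma unip_id x : (forall i, x i i = 1) -> unip x = x.
Proof. by move=> x1; apply/matrixP => i j; rewrite mxE x1 divr1. Qed.

Lemma unip_comm x y : block_trig x -> block_trig y -> x *m y = y *m x ->
  unip x *m unip y = unip y *m unip x.
Proof. by move=> bx b_y cxy; rewrite -!unipM ?cxy. Qed.

Lemma mlog_unipM x y : block_trig x -> block_trig y ->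
    (forall i, x i i != 0) -> (forall i, y i i != 0) -> x *m y = y *m x ->
  mlog (unip (x *m y)) = mlog (unip x) + mlog (unip y).
Proof.
move=> bx b_y x0 y0 cxy; rewrite unipM //; apply: mlogM; try exact: band_unip.
exact: unip_comm.
Qed.

Definition block_first (i : 'I_N) :=
  [forall j : 'I_N, (beta j == beta i) ==> (i <= j)%N].

(** Before a first index there are only indices of other blocks, so its row is purely diagonal. Thus
    [x *m u] determines this diagonal entry once [u i 0] is nonzero. *)
Lemma block_firstE i x (u : 'cV[F]_N) : block_trig x -> block_first i ->
  (x *m u) i 0 = x i i * u i 0.
Proof.
move=> bx /forallP fi; rewrite mxE (bigD1 i) //= big1 ?addr0 // => k ki.
rewrite bx.1 ?mul0r //.
case: (eqVneq (beta i) (beta k)) => //= ik; last by rewrite orbT.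
by have:= fi k; rewrite ik eqxx /= leq_eqVlt val_eqE eq_sym (negPf ki) orbF.
Qed.

Lemma block_first_ex i : exists2 k, block_first k & beta k = beta i.
Proof.
case: (@arg_minnP _ i (fun k => beta k == beta i) (@nat_of_ord N)) => // k.
move=> /eqP ki kmin.
by exists k => //; apply/forallP => j; apply/implyP; rewrite ki; apply: kmin.
Qed.

End BlockTriangular.

(** A block has only one first index, so [beta] is injective on them. *)
Lemma card_block_first (N r : nat) (beta : 'I_N -> 'I_r) :
  (#|[set i | block_first beta i]%SET| <= r)%N.
Proof.
rewrite -{2}(card_ord r); rewrite -(@card_in_imset _ _ beta) ?max_card //.
move=> i j; rewrite !inE => /forallP fi /forallP fj ij; apply/val_inj/eqP => /=.
by rewrite eqn_leq; have:= fi j; have:= fj i; rewrite ij eqxx /= => -> ->.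
Qed.

(** * Cyclic vectors of commuting families of matrices *)

Section CyclicVector.
Variables (F : fieldType) (N : nat).

(** Greedy choice: a nonzero column of the cokernel of [A] is a functional vanishing on the rows
    already chosen, and a member of [S] where it does not vanish is independent of them. *)
Lemma spanning_row_free (S : 'rV[F]_N -> Prop) k :
    (forall c : 'cV[F]_N, c != 0 -> exists2 x, S x & x *m c != 0) ->
  (k <= N)%N -> exists2 A : 'M[F]_(k, N), row_free A & forall i, S (row i A).
Proof.
move=> spanS; elim: k => [|k IHk] kN.
  by exists 0 => [|[]//]; rewrite /row_free mxrank0.
have [A freeA SA] := IHk (ltnW kN).
have /matrix0Pn[i0 [j c0]] : cokermx A != 0.
  by rewrite -mxrank_eq0 mxrank_coker (eqP freeA) subn_eq0 -ltnNge.
have [|x Sx /matrix0Pn[a [b xc]]] := spanS (col j (cokermx A)).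
  by apply/matrix0Pn; exists i0, 0; rewrite mxE.
rewrite !ord1 {a b} in xc.
exists (col_mx x A : 'M[F]_(1 + k, N)) => [|i].
  apply: inj_row_free; rewrite -[k.+1]/(1 + k)%N => v.
  rewrite -[v]hsubmxK mul_row_col => vA.
  have v0 : lsubmx v = 0.
    have := congr1 (mulmx^~ (col j (cokermx A))) vA.
    rewrite mulmxDl -!mulmxA [in A *m _]colE (mulmxA A) mulmx_coker.
    rewrite !mul0mx mulmx0 addr0 => /matrixP/(_ 0 0)/eqP.
    rewrite [X in _ == X]mxE mxE big_ord1 mulf_eq0 (negPf xc) orbF.
    by move=> /eqP v00; apply/matrixP => a b; rewrite !ord1 v00 mxE.
  move: vA; rewrite v0 mul0mx add0r => /eqP.
  by rewrite mulmx_free_eq0 // => /eqP ->; exact: row_mx0.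
rewrite -[k.+1]/(1 + k)%N in i *; case: (split_ordP i) => a ->.
  by rewrite rowKu ord1 row_id.
by rewrite rowKd.
Qed.

Section Centralizer.
Variables (S : 'M[F]_N -> Prop) (u : 'cV[F]_N).
Hypothesis S_comm : forall x y, S x -> S y -> x *m y = y *m x.
Hypothesis S_cyclic : forall c : 'rV[F]_N, c != 0 ->
  exists2 x, S x & c *m (x *m u) != 0.

Lemma cyclic_basis : exists (s : 'I_N -> 'M[F]_N) (a : 'M[F]_N),
  (forall j, S (s j)) /\ forall w, \sum_j (a *m w) j 0 *: s j *m u = w.
Proof.
have [|A freeA SA] := @spanning_row_free
  (fun v => exists2 x, S x & v = (x *m u)^T) N _ (leqnn N).
  move=> c c0; have [|x Sx xc] := S_cyclic (c := c^T).
    by apply: contraNneq c0 => c0; rewrite -[c]trmxK c0 trmx0.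
  exists (x *m u)^T; first by exists x.
  apply: contraNneq xc => xc.
  by rewrite -[c^T *m _]trmxK trmx_mul trmxK xc trmx0.
have /fin_all_exists[s sP] : forall j, exists x, S x /\ row j A = (x *m u)^T.
  by move=> j; have [x] := SA j; exists x.
(* The columns of [A^T] are the basis vectors [s j *m u], so its inverse returns coordinates in that
   basis. *)
exists s, (invmx A^T); split=> [j|w]; first by case: (sP j).
have uA : A^T \in unitmx by rewrite unitmx_tr -row_free_unit.
rewrite -[RHS](mulKVmx uA); apply/matrixP => i k; rewrite ord1 summxE mxE.
apply: eq_bigr => j _; rewrite -scalemxAl mxE mulrC; congr (_ * _).
by have [_ /matrixP/(_ 0 i)] := sP j; rewrite !mxE => <-.
Qed.

(* The [E i] are a dual basis: [x |-> x *m u] maps the centralizer of [S], which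
   is the linear span of [S], bijectively onto the vectors. *)
Lemma cyclic_dual_basis : exists E : 'I_N -> 'M[F]_N,
  [/\ forall i, exists (s : 'I_N -> 'M[F]_N) (a : 'I_N -> F),
         (forall j, S (s j)) /\ E i = \sum_j a j *: s j,
      forall w : 'cV[F]_N, (\sum_i w i 0 *: E i) *m u = w
    & forall x, (forall y, S y -> x *m y = y *m x) ->
         x = \sum_i (x *m u) i 0 *: E i].
Proof.
have [s [a [Ss sP]]] := cyclic_basis.
pose E i := \sum_j a j i *: s j.
have TE (w : 'cV_N) : \sum_i w i 0 *: E i = \sum_j (a *m w) j 0 *: s j.
  under eq_bigr do rewrite scaler_sumr.
  rewrite exchange_big; apply: eq_bigr => j _; rewrite mxE scaler_suml.
  by apply: eq_bigr => i _; rewrite scalerA mulrC.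
have Tu (w : 'cV_N) : (\sum_i w i 0 *: E i) *m u = w.
  by rewrite TE mulmx_suml -[RHS]sP.
have E_comm y i : S y -> y *m E i = E i *m y.
  move=> Sy; rewrite /E mulmx_suml mulmx_sumr; apply: eq_bigr => j _.
  by rewrite -scalemxAl -scalemxAr S_comm.
exists E; split=> // [i|x x_comm]; first by exists s, (a^~ i).
(* The difference [z] commutes with every [s j] and kills [u], so it kills every [s j *m u]; these
   span all vectors. *)
apply/eqP; rewrite -subr_eq0; set T := \sum_i _; set z := x - T.
have zu : z *m u = 0 by rewrite mulmxBl Tu subrr.
have z_comm j : z *m s j = s j *m z.
  rewrite mulmxBl mulmxBr x_comm //; congr (_ - _).
  rewrite mulmx_suml mulmx_sumr; apply: eq_bigr => i _.
  by rewrite -scalemxAl -scalemxAr E_comm.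
have z_sum (v : 'cV_N) : z *m v = 0.
  rewrite -[v]sP mulmx_sumr big1 // => j _.
  by rewrite -scalemxAl -scalemxAr mulmxA z_comm -mulmxA zu mulmx0 scaler0.
apply/eqP/matrixP => i k; have := z_sum (delta_mx k 0).
by rewrite -colE => /matrixP/(_ i 0); rewrite !mxE.
Qed.

End Centralizer.

End CyclicVector.

(** If the rows of the value matrix [H], indexed by [J], are dependent, a relation makes all values
    0. Otherwise [p <= #|J|] gives full column rank, and the first unit vector can be prescribed as
    the list of values. *)
Lemma integral_combination (R : fieldType) (I : finType) (J : {set I}) (p : nat)
    (h : I -> 'I_p -> R) :
  (0 < #|J|)%N -> (p <= #|J|)%N ->
  exists lam : I -> R, [/\ exists i, lam i != 0,
    forall i, i \notin J -> lam i = 0 &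
    forall q, exists z : int, \sum_i lam i * h i q = z%:~R].
Proof.
move=> J0 pJ; pose H := \matrix_(d < #|J|, q < p) h (enum_val d) q.
have [m m0 mH] : exists2 m : 'rV[R]_#|J|, m != 0 &
    forall q, exists z : int, (m *m H) 0 q = z%:~R.
  have [freeH|] := boolP (row_free H); last first.
    rewrite -kermx_eq0 => /matrix0Pn[i [j ij]].
    exists (row i (kermx H)).
      by apply/matrix0Pn; exists 0, j; rewrite mxE.
    by move=> q; exists 0; rewrite -row_mul mulmx_ker row0 mxE.
  have fullH : row_full H.
    by rewrite /row_full eqn_leq rank_leq_col (eqP freeH).
  have p0 : (0 < p)%N.
    by rewrite (leq_trans J0) // -(eqP freeH) rank_leq_col.
  pose e : 'rV[R]_p := delta_mx 0 (Ordinal p0).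
  have eH : e *m pinvmx H *m H = e by rewrite mulmxKpV ?submx_full.
  exists (e *m pinvmx H).
    apply: contraTneq isT => e0; move: eH; rewrite e0 mul0mx.
    by move/matrixP/(_ 0 (Ordinal p0))/eqP; rewrite !mxE !eqxx eq_sym oner_eq0.
  by move=> q; rewrite eH mxE; case: (_ && _); [exists 1 | exists 0].
(* Each fibre of [enum_val] has at most one element: this is [m] extended by zero outside [J]. *)
pose lam i := \sum_(d | enum_val d == i) m 0 d.
have lamE d : lam (enum_val d) = m 0 d.
  rewrite /lam (bigD1 d) //= big1 ?addr0 // => d' /andP[/eqP/enum_val_inj->].
  by rewrite eqxx.
exists lam; split=> [|i iJ|q].
- have /matrix0Pn[i [d]] := m0.
  by rewrite ord1 => md; exists (enum_val d); rewrite lamE.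
- by rewrite /lam big1 // => d /eqP di; move: iJ; rewrite -di enum_valP.
- have [z zE] := mH q; exists z; rewrite -zE mxE.
  rewrite /lam; under eq_bigr do rewrite mulr_suml.
  rewrite (exchange_big_dep xpredT) //=; apply: eq_bigr => d _.
  rewrite (big_pred1 (enum_val d)) ?mxE // => i; exact: eq_sym.
Qed.

(** * Additive coordinates *)

Section LogCoordinates.
Variable R : realType.
Local Notation C := (Cplx R).

(** The norm of [C] is again [C]-valued; its real part is the modulus in [R], to which [ln]
    applies. *)
Definition modc (z : C) : R := complex.Re `|z|.

Lemma modcE (z : C) : (modc z)%:C%C = `|z| :> C.
Proof. exact/RRe_real/normr_real. Qed.

Lemma modcM (z w : C) : modc (z * w) = modc z * modc w.
Proof. by apply: (@complexI R); rewrite rmorphM /= !modcE normrM. Qed.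

Lemma modc_gt0 (z : C) : z != 0 -> 0 < modc z.
Proof. by move=> z0; rewrite -ltcR modcE normr_gt0. Qed.

Lemma modc1 : modc 1 = 1.
Proof. by apply: (@complexI R); rewrite modcE normr1. Qed.

Lemma modc_real (x : R) : 0 <= x -> modc (x%:C%C : C) = x.
Proof. by move=> x0; apply: (@complexI R); rewrite modcE ger0_norm ?lecR. Qed.

Variables (N r : nat) (beta : 'I_N -> 'I_r) (u : 'cV[C]_N).

Definition re_im (b : bool) (z : C) : R :=
  if b then complex.Im z else complex.Re z.

Lemma re_imD b (z w : C) : re_im b (z + w) = re_im b z + re_im b w.
Proof. by case: b z w => [] [? ?] [? ?]. Qed.

Lemma re_im0 b : re_im b 0 = 0.
Proof. by case: b. Qed.

(* The coordinates [(i, true)] with [i] first in its block are dummies: the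
   argument of [x i i] is not an additive real function. *)
Definition log_coord (x : 'M[C]_N) (ib : 'I_N * bool) : R :=
  let: (i, b) := ib in
  if block_first beta i then (if b then 0 else ln (modc (x i i)))
  else re_im b ((mlog (unip x) *m u) i 0).

Lemma log_coordM x y ib : block_trig beta x -> block_trig beta y ->
    (forall i, x i i != 0) -> (forall i, y i i != 0) -> x *m y = y *m x ->
  log_coord (x *m y) ib = log_coord x ib + log_coord y ib.
Proof.
move=> bx b_y x0 y0 cxy; case: ib => i b; rewrite /log_coord.
case: (block_first beta i); last first.
  by rewrite (mlog_unipM bx b_y x0 y0 cxy) mulmxDl mxE re_imD.
case: b; first by rewrite addr0.
rewrite (diag_mulmx _ (block_trig_band bx) (block_trig_band b_y)) modcM lnM //;
  by rewrite posrE modc_gt0.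
Qed.

Section Values.
Variables (E : 'I_N -> 'M[C]_N) (i0 : 'I_N) (lam : 'I_N * bool -> R).
Let T (w : 'cV[C]_N) := \sum_i w i 0 *: E i.
Hypotheses (E_block : forall i, block_trig beta (E i)).
Hypothesis Tu : forall w, T w *m u = w.
Hypothesis T_exp : forall w, mexp (T w) = T (mexp (T w) *m u).
Hypothesis i0_first : block_first beta i0.
Hypothesis lam_i0 : lam (i0, false) = 0.
Hypothesis lam_first : forall i, block_first beta i -> lam (i, true) = 0.

Let T_block w : block_trig beta (T w).
Proof. by apply: block_trig_sum => i; apply: block_trigZ. Qed.

Let T_diag w i : block_first beta i -> T w i i * u i 0 = w i 0.
Proof. by move=> fi; rewrite -(block_firstE u (T_block w) fi) Tu. Qed.

Let u_first i : block_first beta i -> u i 0 != 0.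
Proof.
move=> fi; apply: contra_eq_neq (T_diag (delta_mx i 0) fi) => ->.
by rewrite mulr0 mxE !eqxx eq_sym oner_eq0.
Qed.

(** Since [i] is not first, [T (c *: delta_mx i 0)] has zero diagonal. Its exponential has diagonal
    1, and the logarithm of that, applied to [u], is [c *: delta_mx i 0]; so all coordinates away
    from index [i] are zero. *)
Let half_at_nonfirst i b : ~~ block_first beta i -> lam (i, b) != 0 ->
  exists w : 'cV[C]_N, [/\ w i0 0 = u i0 0, forall k, T w k k != 0 &
    \sum_ib lam ib * log_coord (T w) ib = 2^-1].
Proof.
(* The choice of [s] gives [lam (i, b) * s = 1/2]; [c] carries [s] in the part selected by [b]. *)
move=> fi lami; pose s : R := (2 * lam (i, b))^-1.
pose c : C := if b then Complex 0 s else Complex s 0.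
pose v : 'cV[C]_N := c *: delta_mx i 0.
pose x := mexp (T v).
have diagTv k : T v k k = 0.
  have [k' fk' kk'] := block_first_ex beta k.
  rewrite -((T_block v).2 k' k kk'); apply: (mulIf (u_first fk')).
  rewrite T_diag // mul0r !mxE eqxx andbT.
  by case: eqP fk' fi => [-> ->|_ _ _] //; rewrite mulr0.
have bTv : band 1 (T v).
  move=> j k; rewrite addn1 ltnS leq_eqVlt => /orP[/eqP/val_inj <-|jk].
    exact: diagTv.
  by apply: (T_block v).1; rewrite jk.
have bx : band 1 (x - 1) by apply: band_mexpB1.
have x1 k : x k k = 1.
  have := bx k k; rewrite addn1 ltnSn !mxE eqxx => /(_ isT)/eqP.
  by rewrite subr_eq0 => /eqP.
have xT : T (x *m u) = x by rewrite /x -T_exp.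
exists (x *m u); rewrite xT; split=> [|k|].
- have bX : block_trig beta x by rewrite -xT.
  by rewrite (block_firstE u bX i0_first) x1 mul1r.
- by rewrite x1 oner_eq0.
have coordE ib : log_coord x ib = if ib.1 == i then re_im ib.2 c else 0.
  case: ib => k b'; rewrite /log_coord x1 modc1 ln1 if_same unip_id //.
  rewrite /x mexpK // Tu !mxE eqxx andbT.
  case: eqP => [->|_]; first by rewrite (negPf fi) mulr1.
  by rewrite mulr0 re_im0 if_same.
under eq_bigr do rewrite coordE.
rewrite (bigD1 (i, b)) //= big1 ?addr0 => [|[k b'] /=].
  rewrite eqxx; have -> : re_im b c = s by rewrite /c; case: (b).
  by rewrite /s invfM mulrCA divff // mulr1.
case: (k =P i) => [->|_ _]; last by rewrite mulr0.
rewrite xpair_eqE eqxx /c; case: (b) b' => [] [] //= _; exact: mulr0.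
Qed.

(** Only moduli remain: rescaling the entry of [u] at [i] by [e = exp s] turns the diagonal of that
    block alone from 1 into [e], and [ln e = s]. *)
Let half_at_first i : block_first beta i -> lam (i, false) != 0 ->
    (forall k b, ~~ block_first beta k -> lam (k, b) = 0) ->
  exists w : 'cV[C]_N, [/\ w i0 0 = u i0 0, forall k, T w k k != 0 &
    \sum_ib lam ib * log_coord (T w) ib = 2^-1].
Proof.
move=> fi lami lam_nonfirst; pose s : R := (2 * lam (i, false))^-1.
pose e : C := ((expR s)%:C)%C.
have e0 : e != 0 by rewrite /e (inj_eq (@complexI R) _ 0) gt_eqF ?expR_gt0.
pose w : 'cV[C]_N := \col_k ((if k == i then e else 1) * u k 0).
(* [w] keeps the entry of [u] at [i0], because the coefficient of [(i0, false)] is zero. *)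
have i0i : i0 == i = false.
  by apply: contraNF lami => /eqP <-; rewrite lam_i0.
have Tw k : block_first beta k -> T w k k = if k == i then e else 1.
  by move=> fk; apply: (mulIf (u_first fk)); rewrite T_diag // mxE.
exists w; split=> [|k|].
- by rewrite mxE i0i mul1r.
- have [k' fk' kk'] := block_first_ex beta k.
  rewrite -((T_block w).2 k' k kk') Tw //; case: ifP => // _; exact: oner_neq0.
rewrite (bigD1 (i, false)) //= big1 ?addr0 => [|[k b] kb].
  rewrite fi Tw // eqxx modc_real ?expR_ge0 // expRK /s invfM mulrCA divff //.
  exact: mulr1.
have [fk|fk] := boolP (block_first beta k); last by rewrite lam_nonfirst ?mul0r.
case: b kb => [_|kb]; first by rewrite lam_first ?mul0r.
rewrite /log_coord fk Tw //; move: kb.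
rewrite xpair_eqE eqxx andbT => /negPf ->.
by rewrite modc1 ln1 mulr0.
Qed.

Lemma half_integral_point : (exists ib, lam ib != 0) ->
  exists w : 'cV[C]_N, [/\ w i0 0 = u i0 0, forall k, T w k k != 0 &
    \sum_ib lam ib * log_coord (T w) ib = 2^-1].
Proof.
move=> [[i b] lami].
have [[k [b' [fk lamk]]]|nex] := pselect (exists k b',
    ~~ block_first beta k /\ lam (k, b') != 0).
  exact: half_at_nonfirst lamk.
have lam0 k b' : ~~ block_first beta k -> lam (k, b') = 0.
  by move=> fk; apply: contrapT => /eqP lamk; apply: nex; exists k, b'.
have fi : block_first beta i by apply: contraNT lami => /lam0 ->.
apply: (half_at_first fi) => //.
by case: b lami => //; rewrite lam_first ?eqxx.
Qed.

End Values.

End LogCoordinates.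

(** * Continuity *)

Lemma KK_block_trig (F : numFieldType) (N r : nat) (eta : 'I_r -> nat)
    (eta_sum : (\sum_(i < r) eta i)%N = N) (x : 'M[F]_N) :
  KK eta_sum x ->
  block_trig (fun s => tagnat.sig1 (cast_ord (esym eta_sum) s)) x.
Proof.
case: _ / eta_sum x => _ [B TB <-]; rewrite castmx_id /block_trig.
split=> i j; rewrite !cast_ord_id.
  case/orP=> [ij|/negPf ij]; last by rewrite mxE ij mxE.
  suff /is_trig_mxP -> : is_trig_mx (\mxdiag_k B k) by [].
  apply/is_trig_mxblockP; split=> [k l kl|k]; last first.
    by rewrite eqxx conform_mx_id; case: (TB k).
  by rewrite -val_eqE ltn_eqF.
rewrite !mxE !eqxx !conform_mx_id.
move: (tagnat.sig2 i) (tagnat.sig2 j) => a b ij; case: _ / ij b => b.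
by case: (TB (tagnat.sig1 i)).
Qed.

Section MatrixContinuity.
Variables (K : numFieldType) (X : topologicalType) (p : X).

(** Entrywise continuity at [p], so that each operation reduces to limits in [K]. *)
Definition mx_continuous m n (f : X -> 'M[K]_(m, n)) :=
  forall i j, {for p, continuous (fun y => f y i j)}.

Lemma mx_continuous_cst m n (a : 'M[K]_(m, n)) : mx_continuous (fun=> a).
Proof. by move=> i j; apply: cvg_cst. Qed.

Lemma continuous_sum_at I (s : seq I) (f : I -> X -> K) :
  (forall i, {for p, continuous (f i)}) ->
  {for p, continuous (fun y => \sum_(i <- s) f i y)}.
Proof.
move=> cf; rewrite /prop_for /continuous_at; elim: s => [|i s IHs].
  by under eq_fun do rewrite big_nil; rewrite big_nil; apply: cvg_cst.
under eq_fun do rewrite big_cons; rewrite big_cons.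
by apply: cvgD; [exact: cf | exact: IHs].
Qed.

Variables m n : nat.
Implicit Types f g : X -> 'M[K]_(m, n).

Lemma mx_continuousD f g : mx_continuous f -> mx_continuous g ->
  mx_continuous (fun y => f y + g y).
Proof.
move=> cf cg i j; rewrite /prop_for /continuous_at.
under eq_fun do rewrite mxE; rewrite mxE.
by apply: cvgD; [exact: cf | exact: cg].
Qed.

Lemma mx_continuousZ (a : X -> K) f :
  {for p, continuous a} -> mx_continuous f ->
  mx_continuous (fun y => a y *: f y).
Proof.
move=> ca cf i j; rewrite /prop_for /continuous_at.
under eq_fun do rewrite mxE; rewrite mxE.
by apply: cvgM; [exact: ca | exact: cf].
Qed.

Lemma mx_continuous_sum I (s : seq I) (f : I -> X -> 'M[K]_(m, n)) :
  (forall i, mx_continuous (f i)) ->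
  mx_continuous (fun y => \sum_(i <- s) f i y).
Proof.
move=> cf i j; rewrite /prop_for /continuous_at.
under eq_fun do rewrite summxE; rewrite summxE.
by apply: continuous_sum_at => k; exact: cf.
Qed.

Lemma mx_continuousM q f (g : X -> 'M[K]_(n, q)) :
  mx_continuous f -> mx_continuous g -> mx_continuous (fun y => f y *m g y).
Proof.
move=> cf cg i j; rewrite /prop_for /continuous_at.
under eq_fun do rewrite mxE; rewrite mxE.
by apply: continuous_sum_at => k; apply: cvgM; [exact: cf | exact: cg].
Qed.

End MatrixContinuity.

Section LogContinuity.
Variables (K : numFieldType) (X : topologicalType) (p : X) (N : nat).
Implicit Types f : X -> 'M[K]_N.

Lemma mx_continuousN f : mx_continuous p f -> mx_continuous p (fun y => - f y).
Proof.
move=> cf; under eq_fun do rewrite -scaleN1r.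
by apply: (mx_continuousZ (a := fun=> -1)) => //; exact: cvg_cst.
Qed.

Lemma mx_continuous_mexp f : mx_continuous p f ->
  mx_continuous p (fun y => mexp (f y)).
Proof.
move=> cf; apply: mx_continuous_sum => i.
apply: (mx_continuousZ (a := fun=> _)); first exact: cvg_cst.
elim: (i : nat) => [|k IHk]; first exact: mx_continuous_cst.
by under eq_fun do rewrite exprS; exact: mx_continuousM cf IHk.
Qed.

Lemma mx_continuous_mlog f : mx_continuous p f ->
  mx_continuous p (fun y => mlog (f y)).
Proof.
move=> cf; rewrite /mlog.
have fB1 : mx_continuous p (fun y => f y - 1).
  by apply: mx_continuousD => //; exact: mx_continuous_cst.
suff : forall k (g : X -> 'M[K]_N), mx_continuous p g ->
    mx_continuous p (fun y => mlog_rec k (g y)) by exact.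
elim=> [|k IHk] g cg /=; first exact: mx_continuous_cst.
apply: mx_continuousD => //; apply: IHk.
apply: mx_continuousD; last exact: mx_continuous_cst.
apply: mx_continuousM; last exact/mx_continuous_mexp/mx_continuousN.
by apply: mx_continuousD => //; exact: mx_continuous_cst.
Qed.

Lemma mx_continuous_unip f : mx_continuous p f -> (forall i, f p i i != 0) ->
  mx_continuous p (fun y => unip (f y)).
Proof.
move=> cf f0 i j; rewrite /prop_for /continuous_at.
under eq_fun do rewrite mxE; rewrite mxE.
by apply: cvgM; [exact: cf | apply: cvgV => //; exact: cf].
Qed.

End LogContinuity.

Section LogCoordContinuity.
Variable R : realType.
Local Notation C := (Cplx R).

Lemma re_im_le b (z : C) : `|re_im b z| <= modc z.
Proof.
have -> : modc z = Num.sqrt (complex.Re z ^+ 2 + complex.Im z ^+ 2).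
  by rewrite /modc normc_def.
by rewrite -sqrtr_sqr ler_wsqrtr //; case: b; rewrite /= ?lerDl ?lerDr sqr_ge0.
Qed.

Lemma re_imB b (z w : C) : re_im b (z - w) = re_im b z - re_im b w.
Proof. by case: b z w => [] [? ?] [? ?]. Qed.

Lemma re_im_continuous b : continuous (re_im b : C -> R).
Proof.
move=> z; apply/(@cvgrPdist_lt _ _ _ _ (nbhs_filter z)) => e e0.
have e0' : 0 < (e%:C%C : C) by rewrite ltcR.
near=> y; rewrite -re_imB; apply: le_lt_trans (re_im_le _ _) _.
rewrite -ltcR modcE.
by near: y; apply: cvgr_dist_lt.
Unshelve. all: by end_near.
Qed.

Lemma modc_continuous : continuous (@modc R).
Proof.
move=> z; apply: (@continuous_comp _ _ _ (fun z : C => `|z|) (re_im false)).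
  exact: norm_continuous.
exact: re_im_continuous.
Qed.

Lemma log_coord_continuous (N r : nat) (beta : 'I_N -> 'I_r) (u : 'cV[C]_N)
    (X : topologicalType) (p : X) (f : X -> 'M[C]_N) ib :
  mx_continuous p f -> (forall i, f p i i != 0) ->
  {for p, continuous (fun y => log_coord beta u (f y) ib)}.
Proof.
move=> cf f0; case: ib => i b; rewrite /log_coord.
case: (block_first beta i); last first.
  apply: (@continuous_comp _ _ _
    (fun y => (mlog (unip (f y)) *m u) i 0) (re_im b)).
    apply: mx_continuousM; last exact: mx_continuous_cst.
    exact/mx_continuous_mlog/mx_continuous_unip.
  exact: re_im_continuous.
case: b; first exact: cvg_cst.
apply: (@continuous_comp _ _ _ (fun y => modc (f y i i)) (@ln R)).
  apply: (@continuous_comp _ _ _ (fun y => f y i i) (@modc R)); first exact: cf.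
  exact: modc_continuous.
exact/continuous_ln/modc_gt0.
Qed.

Lemma log_comb_continuous (N r : nat) (beta : 'I_N -> 'I_r) (u : 'cV[C]_N)
    (lam : 'I_N * bool -> R) (X : topologicalType) (p : X) (f : X -> 'M[C]_N) :
  mx_continuous p f -> (forall i, f p i i != 0) ->
  {for p, continuous (fun y => \sum_ib lam ib * log_coord beta u (f y) ib)}.
Proof.
move=> cf f0; apply: continuous_sum_at => ib.
by apply: cvgMl_tmp; exact: log_coord_continuous.
Qed.

End LogCoordContinuity.

Lemma dense_nbhs (X : topologicalType) (D A : set X) (x : X) :
  dense D -> nbhs x A -> exists2 y, D y & A y.
Proof.
move=> dD xA; have [|y [Ay Dy]] := dD _ _ (open_interior A).
  by exists x.
by exists y => //; exact: interior_subset Ay.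
Qed.

(** * Homogeneous coordinates *)

Section Lift.
Variables (F : fieldType) (n : nat).

(** On these vectors the matrix [Phi f] acts as the affine map [f]. *)
Definition lift1 (y : 'cV[F]_n) : 'cV[F]_(1 + n) := col_mx 1%:M y.

Lemma Phi1 : Phi (1%g : GA F n) = 1%:M.
Proof. by rewrite /Phi scalar_mx_block. Qed.

Lemma Phi_lift1 (f : GA F n) y : Phi f *m lift1 y = lift1 (aff_app f y).
Proof.
by rewrite /Phi /lift1 mul_block_col !mul1mx mul0mx addr0 mulmx1 addrC.
Qed.

Lemma invPhi_lift1 (f : GA F n) y :
  invmx (Phi f) *m lift1 y = lift1 (aff_app (f^-1)%g y).
Proof.
apply: (canLR (mulKmx (Phi_unit f))); rewrite Phi_lift1 -aff_app_mul mulgV.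
by rewrite /aff_app mul1mx addr0.
Qed.

Lemma lift1_surj (w : 'cV[F]_(1 + n)) : w (lshift n 0) 0 = 1 ->
  exists y, w = lift1 y.
Proof.
move=> w0; exists (dsubmx w); rewrite -[LHS]vsubmxK; congr col_mx.
by apply/matrixP => i j; rewrite !ord1 !mxE.
Qed.

(** The hyperplane spans: [y = 0] gives the first column of [d], then unit vectors give the
    others. *)
Lemma lift1_eq0 m (d : 'M[F]_(m, 1 + n)) :
  (forall y, d *m lift1 y = 0) -> d = 0.
Proof.
move=> d0; have dE y : lsubmx d + rsubmx d *m y = 0.
  by rewrite -[RHS](d0 y) -[in RHS](hsubmxK d) mul_row_col mulmx1.
have l0 : lsubmx d = 0 by rewrite -[RHS](dE 0) mulmx0 addr0.
suff r0 : rsubmx d = 0 by rewrite -[d]hsubmxK l0 r0 row_mx0.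
apply/matrixP => i j; have := dE (delta_mx j 0); rewrite l0 add0r -colE.
by move/matrixP/(_ i 0); rewrite !mxE.
Qed.

End Lift.

Lemma lift1_continuous (K : numFieldType) n (y : 'cV[K]_n) :
  mx_continuous y (@lift1 K n).
Proof.
move=> i j; rewrite /prop_for /continuous_at /lift1.
case: (split_ordP i) => k ->.
  have -> : (fun z : 'cV[K]_n => col_mx 1%:M z (lshift n k) j) =
      fun=> (1%:M : 'M[K]_1) k j.
    by apply: funext => z; rewrite col_mxEu.
  by rewrite col_mxEu; exact: (@cvg_cst _ _ _ _ (nbhs_filter y)).
have -> : (fun z : 'cV[K]_n => col_mx 1%:M z (rshift 1 k : 'I_(1 + n)) j) =
    fun z => z k j.
  by apply: funext => z; rewrite col_mxEd.
by rewrite col_mxEd; apply: coord_continuous.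
Qed.

(** * Counting coordinates and integrality on generated subgroups *)

Lemma intr_notin01 (R : numDomainType) (z : int) :
  0 < z%:~R :> R -> z%:~R < 1 :> R -> False.
Proof. by rewrite ltr0z -[1]/(1%:~R) ltr_int; case: z => [[|[|]]|]. Qed.

(** The removed pairs are [(i0, false)] and one dummy per first index, at most [1 + minn r N] out of
    [2 * N]. *)
Lemma card_log_coord (N r : nat) (beta : 'I_N -> 'I_r) (i0 : 'I_N) :
  (2 * N <= minn r N + 1 +
     #|~: ((i0, false) |:
           [set (i, true) | i in [set i | block_first beta i]])%SET|)%N.
Proof.
set A := (_ |: _)%SET.
have := cardsC A; rewrite card_prod card_bool card_ord.
have : (#|A| <= 1 + minn r N)%N.
  rewrite cardsU1 leq_add ?leq_b1 // (leq_trans (leq_imset_card _ _)) //.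
  by rewrite leq_min card_block_first (leq_trans (max_card _)) ?card_ord.
lia.
Qed.

Lemma subgroup1 (gT : groupType) (G : set gT) : is_subgroup G -> G 1%g.
Proof. by case; rewrite inE. Qed.

Lemma subgroup_div (gT : groupType) (G : set gT) f h :
  is_subgroup G -> G f -> G h -> G (f / h)%g.
Proof. by move=> [_ /(_ f h)]; rewrite !inE => GD Gf Gh; apply: GD. Qed.

(** The elements of [G] with integral [psi] form a subgroup containing the generators; additivity
    handles quotients through [f = (f / h) * h]. *)
Lemma generated_integral (gT : groupType) (R : pzRingType) (G : set gT)
    (p : nat) (g : 'I_p -> gT) (psi : gT -> R) :
  is_subgroup G -> G = generated_by (range g) ->
  (forall f h, G f -> G h -> psi (f * h)%g = psi f + psi h) ->
  (forall q, exists z : int, psi (g q) = z%:~R) ->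
  forall f, G f -> exists z : int, psi f = z%:~R.
Proof.
move=> G_subgroup GE psiM psi_g; have G1 := subgroup1 G_subgroup.
have psi1 : psi 1%g = 0.
  by apply: (addrI (psi 1%g)); rewrite -psiM // mulg1 addr0.
suff : G `<=` [set f | G f /\ exists z : int, psi f = z%:~R].
  by move=> sub f /sub[].
rewrite {1}GE; apply: smallest_sub => [|_ [q _ <-]]; last first.
  by split; [rewrite GE; apply: sub_gen_smallest; exists q | exact: psi_g].
split=> [|f h]; rewrite !inE; first by split=> //; exists 0; rewrite psi1.
move=> [Gf [z fz]] [Gh [z' hz]]; have Gfh := subgroup_div G_subgroup Gf Gh.
split=> //; exists (z - z'); rewrite rmorphB /= -fz -hz.
by apply/eqP; rewrite eq_sym subr_eq -psiM ?mulgVK.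
Qed.

(** * Absence of dense orbits *)

Theorem corollary1p3 (R : realType) (n p : nat) (n_ge1 : (1 <= n)%N)
    (G : set (GA (Cplx R) n))
    (G_subgroup : is_subgroup G)
    (G_abelian : is_abelian G)
    (G_generated : generated_by_elements p G)
    (r : nat) (eta : 'I_r -> nat)
    (eta_gt0 : forall i, (0 < eta i)%N)
    (eta_sum : (\sum_(i < r) eta i)%N = (1 + n)%N)
    (P : 'M[Cplx R]_(1 + n))
    (P_affine : range (@Phi (Cplx R) n) P)
    (G_normal_form :
       [set invmx P *m M *m P | M in @Phi (Cplx R) n @` G]
         `<=` KKstar eta_sum `&` range (@Phi (Cplx R) n))
    (p_le : (p <= 2 * n - r + 1)%N) :
  ~ exists v : 'cV[Cplx R]_n, dense (orbit_of G v).
Proof.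
move=> [v dense_v].
have [g GE] := G_generated.
have [a _ aP] := P_affine.
have uP : P \in unitmx by rewrite -aP Phi_unit.
pose m f := invmx P *m Phi f *m P.
pose u := invmx P *m lift1 v.
pose beta s := tagnat.sig1 (cast_ord (esym eta_sum) s).
pose S x := exists2 f, G f & x = m f.
have mM f h : m (f * h)%g = m f *m m h.
  by rewrite /m Phi_mul !mulmxA (mulmxK uP).
have m1 : m 1%g = 1%:M.
  by rewrite /m Phi1 mulmx1 mulVmx.
have mu f : m f *m u = invmx P *m lift1 (aff_app f v).
  by rewrite /m /u -!mulmxA (mulKVmx uP) Phi_lift1.
have m_block f : G f -> block_trig beta (m f).
  move=> Gf; apply: KK_block_trig.
  by have [|[]] := G_normal_form (m f); first by exists (Phi f) => //; exists f.
clearbody m.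
have S_comm x y : S x -> S y -> x *m y = y *m x.
  move=> [f Gf ->] [h Gh ->].
  by rewrite -!mM (G_abelian _ _ Gf Gh).
(* The diagonals of [m f] and [m (f^-1)] multiply to 1, entry by entry. *)
have m_diag f : G f -> forall i, m f i i != 0.
  move=> Gf i; have Gf' : G (f^-1)%g.
    by rewrite -div1g; apply: subgroup_div => //; exact: subgroup1.
  have := diag_mulmx i (block_trig_band (m_block _ Gf))
    (block_trig_band (m_block _ Gf')).
  rewrite -mM (mulgV f) m1 mxE eqxx => e; apply: contra_eq_neq e => ->.
  by rewrite mul0r oner_neq0.
(* The functional [c *m invmx P] is nonzero at some point of the hyperplane, hence nearby by
   continuity, hence at a point of the dense orbit. *)
have S_cyclic (c : 'rV_(1 + n)) : c != 0 -> exists2 x, S x & c *m (x *m u) != 0.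
  move=> c0; have [y cy] : exists y, (c *m invmx P *m lift1 y) 0 0 != 0.
    apply: contrapT => nex; move: c0; rewrite -[c](mulmxKV uP).
    rewrite (@lift1_eq0 _ _ _ (c *m invmx P)) ?mul0mx ?eqxx // => y.
    apply/matrixP => i j; rewrite !ord1 [RHS]mxE; apply: contrapT => /eqP cy.
    by apply: nex; exists y.
  have cont : mx_continuous y (fun z => c *m invmx P *m lift1 z).
    apply: mx_continuousM; first exact: mx_continuous_cst.
    exact: lift1_continuous.
  have [_ [f Gf <-] /= cf] := dense_nbhs dense_v (cvgr_neq0 _ (cont 0 0) cy).
  exists (m f); first by exists f.
  apply: contraNneq cf => cf.
  by rewrite -mulmxA -mu cf mxE.
have [E [E_span Tu T_dual]] := cyclic_dual_basis S_comm S_cyclic.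
pose T (w : 'cV[Cplx R]_(1 + n)) := \sum_i w i 0 *: E i.
have E_block i : block_trig beta (E i).
  have [s [b [Ss ->]]] := E_span i.
  apply: block_trig_sum => j; apply: block_trigZ.
  by have [f Gf ->] := Ss j; apply: m_block.
have T_comm w y : S y -> y *m T w = T w *m y.
  move=> Sy; rewrite mulmx_sumr mulmx_suml; apply: eq_bigr => i _.
  rewrite -scalemxAl -scalemxAr; congr (_ *: _).
  have [s [b [Ss ->]]] := E_span i; rewrite mulmx_sumr mulmx_suml.
  by apply: eq_bigr => j _; rewrite -scalemxAl -scalemxAr S_comm.
have T_exp w : mexp (T w) = T (mexp (T w) *m u).
  by apply: T_dual => y Sy; apply/esym/comm_mexp/T_comm.
(* On orbit points [T] returns the group matrix itself, so [psi] composed with [T] extends the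
   values on the group off the orbit. *)
have Tm f : G f -> T (invmx P *m lift1 (aff_app f v)) = m f.
  move=> Gf; rewrite -mu; apply/esym/T_dual => y Sy.
  by apply: S_comm => //; exists f.
pose i0 : 'I_(1 + n) := lshift n 0.
have i0_first : block_first beta i0.
  by apply/forallP => j; rewrite leq0n implybT.
have cardJ := card_log_coord beta i0; set J := (~: _)%SET in cardJ.
(* Here [N = 1 + n], so [#|J| >= 2 * n + 1 - minn r (1 + n)]: at least [n], hence positive, and at
   least [p]. *)
have [||lam [lam_neq0 lamJ lamZ]] := @integral_combination R _ J p
  (fun ib q => log_coord beta u (m (g q)) ib); [lia | lia |].
have lam_i0 : lam (i0, false) = 0.
  by apply: lamJ; rewrite !inE eqxx.
have lam_first i : block_first beta i -> lam (i, true) = 0.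
  move=> fi; apply: lamJ; rewrite !inE negbK; apply/orP; right.
  by apply/imsetP; exists i => //; rewrite inE.
pose psi x := \sum_ib lam ib * log_coord beta u x ib.
have psiM f h : G f -> G h -> psi (m (f * h)%g) = psi (m f) + psi (m h).
  move=> Gf Gh; rewrite -big_split; apply: eq_bigr => ib _ /=.
  have cfh : m f *m m h = m h *m m f by apply: S_comm; [exists f | exists h].
  by rewrite mM (log_coordM u ib (m_block _ Gf) (m_block _ Gh)
    (m_diag _ Gf) (m_diag _ Gh) cfh) mulrDr.
have psiZ : forall f, G f -> exists z : int, psi (m f) = z%:~R.
  apply: (generated_integral (psi := psi \o m) G_subgroup GE psiM).
  exact: lamZ.
have [w [w0 Tw_diag psi_w]] :=
  half_integral_point E_block Tu T_exp i0_first lam_i0 lam_first lam_neq0.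
(* [P] and its inverse come from affine maps and so preserve the hyperplane of first entry 1, which
   contains [u] and therefore [w]. *)
have [y wy] : exists y, w = invmx P *m lift1 y.
  have [|y yE] := @lift1_surj _ _ (P *m w).
    have [y uy] : exists y, u = lift1 y by rewrite /u -aP invPhi_lift1; eexists.
    have w_lift : w = lift1 (dsubmx w).
      rewrite -[LHS]vsubmxK; congr col_mx; apply/matrixP => i j.
      by rewrite !ord1 mxE w0 uy col_mxEu.
    by rewrite w_lift -aP Phi_lift1 col_mxEu mxE.
  by exists y; rewrite -yE mulKmx.
have psi_y : psi (T (invmx P *m lift1 y)) = 2^-1 by rewrite -wy; exact: psi_w.
have cont : {for y, continuous
    (fun z : 'cV[Cplx R]_n => psi (T (invmx P *m lift1 z)))}.
  apply: log_comb_continuous; last by rewrite -wy.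
  apply: mx_continuous_sum => i.
  apply: mx_continuousZ; last exact: mx_continuous_cst.
  apply: mx_continuousM; [exact: mx_continuous_cst | exact: lift1_continuous].
have half_gt0 : 0 < 2^-1 :> R by rewrite invr_gt0 ltr0n.
clearbody psi T.
(* Density gives an orbit point where [psi] is less than 1/2 away from 1/2: an integer strictly
   between 0 and 1. *)
have [_ [f Gf <-]] := dense_nbhs dense_v (cvgr_dist_lt _ _ cont _ half_gt0).
rewrite psi_y (Tm f Gf); have [z ->] := psiZ f Gf.
rewrite ltr_norml => /andP[z0 z1].
by apply: (@intr_notin01 R z); lra.
Qed.
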